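(* Let $1<\alpha<\beta$ be irrational numbers with $\frac1\alpha+\frac1\beta=1$. Then for every positive integer $n$, $$[n\beta]-[n\alpha]=\left[n\left(\frac{\beta}{\alpha}-1\right)\right]+\left[n\left(1-\frac{\alpha}{\beta}\right)\right]+1.$$
   Context: $[x]$ denotes the largest integer not exceeding the real number $x$. *)

(* Defs.v *)
From mathcomp Require Import all_boot all_order all_algebra.
From mathcomp Require Import all_classical reals.

(* Main.v *)
(** Clearing denominators, [alpha + beta = alpha * beta], so
    [beta / alpha - 1 = beta - 2] and [1 - alpha / beta = 2 - alpha]. Integer
    shifts by [2 n] pull out of the floors and cancel, and
    [floor (- x) = - floor x - 1] for [x = n * alpha], which is irrational. *)

Require Import Defs.
From mathcomp Require Import all_boot all_order all_algebra.
From mathcomp Require Import all_classical reals.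
From mathcomp Require Import ring lra.
Import Order.TTheory GRing.Theory Num.Theory.

Local Open Scope ring_scope.

(** The ceiling of [x] is [- Num.floor (- x)], and off the integers it exceeds the floor by one. *)
Lemma floorN_nint (R : archiRealDomainType) (x : R) :
  x \isn't a Num.int -> Num.floor (- x) = - Num.floor x - 1.
Proof.
by move=> xN; have := ceil_floor x; rewrite ceilNfloor xN => /eqP;
  rewrite eqr_oppLR opprD => /eqP.
Qed.

Lemma irrational_natM_nint (R : realType) (x : R) (n : nat) :
  (0 < n)%N -> irrational x -> n%:R * x \isn't a Num.int.
Proof.
move=> n_gt0 x_irr; apply/negP => /intrP[m nxE]; apply: x_irr.
exists (m%:~R / n%:R) => //.
rewrite fmorph_div /= ratr_int ratr_nat -nxE mulrC mulKf//.
by rewrite pnatr_eq0 -lt0n.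
Qed.

Theorem corollary1p1 (R : realType) (alpha beta : R)
    (irr_alpha : irrational alpha) (irr_beta : irrational beta)
    (alpha_gt1 : 1 < alpha) (alpha_lt_beta : alpha < beta)
    (inv_sum : 1 / alpha + 1 / beta = 1)
    (n : nat) (n_gt0 : (0 < n)%N) :
  Num.floor (n%:R * beta) - Num.floor (n%:R * alpha) =
    Num.floor (n%:R * (beta / alpha - 1)) +
    Num.floor (n%:R * (1 - alpha / beta)) + 1.
Proof.
have alpha_neq0 : alpha != 0 by lra.
have beta_neq0 : beta != 0 by lra.
have sum_eq_prod : alpha + beta = alpha * beta.
  by rewrite -[RHS]mulr1 -inv_sum; field; apply/andP.
have ba : beta / alpha = beta - 1.
  (* Multiplied by [alpha], this is [sum_eq_prod], linear once [alpha * beta] is taken as an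
     atom. *)
  by apply: (mulIf alpha_neq0); rewrite divfK//; lra.
have ab : alpha / beta = alpha - 1.
  by apply: (mulIf beta_neq0); rewrite divfK//; lra.
(* The shift is written as an integer cast so that [floorDrz] can extract it. *)
have -> : n%:R * (beta / alpha - 1) = n%:R * beta + (- (n * 2)%:Z)%:~R.
  by rewrite ba rmorphN /= -pmulrn natrM; ring.
have -> : n%:R * (1 - alpha / beta) = - (n%:R * alpha) + (n * 2)%:Z%:~R.
  by rewrite ab -pmulrn natrM; ring.
rewrite !floorDrz ?intr_int// !intrKfloor.
(* The [- 1] from negating [n%:R * alpha] cancels the final [+ 1]. *)
by rewrite floorN_nint ?irrational_natM_nint//; ring.
Qed.
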